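(* Let $[a,b]\subset[-1,1]$, $\alpha=\arccos(a)$, $\beta=\arccos(b)$ with $\alpha>\beta$. Let $h$ be the step function on $[-1,1]$ with $h(x)=1$ for $x\in(a,b)$, $h(a)=h(b)=\tfrac12$ and $h(x)=0$ for $x\in[-1,1]\setminus[a,b]$; put $g(\theta)=h(\cos\theta)$, and let $q_d(\theta)=\frac{c_0}{2}+\sum_{j=1}^{d}\rho_{j,d}c_j\cos(j\theta)$ be its Chebyshev--Jackson trigonometric polynomial of degree $d$. For $\theta\in[0,\pi]$ with $\theta\neq\alpha,\beta$, define $$\Delta_\theta=\min\{|\theta-\alpha|,|\theta-\beta|\}.$$ Then for every integer $d\ge 2$, $$|q_d(\theta)-g(\theta)|\le\frac{\pi^6}{2(d+2)^3\Delta_\theta^4}.$$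
   Context: The Fourier coefficients are $c_0=\frac{2}{\pi}(\arccos(a)-\arccos(b))$ and $c_j=\frac{2}{\pi}\,\frac{\sin(j\arccos(a))-\sin(j\arccos(b))}{j}$ for $j=1,\dots,d$. The Jackson damping factors are $$\rho_{j,d}=\frac{(d+2-j)\sin(\frac{\pi}{d+2})\cos(\frac{j\pi}{d+2})+\cos(\frac{\pi}{d+2})\sin(\frac{j\pi}{d+2})}{(d+2)\sin\frac{\pi}{d+2}}.$$ *)

(* Defs.v *)
(* Stdlib real numbers; acos is the principal value, with range [0, PI] on
   [-1, 1]. *)
From Stdlib Require Import Reals.
From Coquelicot Require Import Coquelicot.
Open Scope R_scope.

Definition step (a b x : R) : R :=
  if Req_dec_T x a then 1 / 2
  else if Req_dec_T x b then 1 / 2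
  else if Rlt_dec a x then (if Rlt_dec x b then 1 else 0)
  else 0.

Definition step_cos (a b theta : R) : R := step a b (cos theta).

Definition fourier_coef (a b : R) (j : nat) : R :=
  match j with
  | O => 2 / PI * (acos a - acos b)
  | S _ => 2 / PI * ((sin (INR j * acos a) - sin (INR j * acos b)) / INR j)
  end.

Definition jackson (d j : nat) : R :=
  let N := INR d + 2 in
  ((N - INR j) * sin (PI / N) * cos (INR j * PI / N)
   + cos (PI / N) * sin (INR j * PI / N))
  / (N * sin (PI / N)).

Definition cheb_jackson (a b : R) (d : nat) (theta : R) : R :=
  fourier_coef a b 0 / 2
  + sum_n_m (fun j => jackson d j * fourier_coef a b j * cos (INR j * theta))
            1 d.

Definition jump_dist (a b theta : R) : R :=
  Rmin (Rabs (theta - acos a)) (Rabs (theta - acos b)).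

(* Main.v *)
Require Import Defs.
From Stdlib Require Import Reals Lra Lia ZArith.
From Coquelicot Require Import Coquelicot.
Open Scope R_scope.

(** Write N = d + 2, r_j for the Jackson factors, alpha = acos a,
    beta = acos b, and let u(t) = 1/2 + sum_{j=1}^d r_j cos(j t) be the Jackson
    kernel, so that q_d is the convolution of g with u / PI.  Two properties of
    u give the estimate.

    Positivity: N r_j / 2 is the autocorrelation at lag j of the sequence
    sin((k+1) PI / N), 0 <= k <= d ([jackson_autocorrelation]), so N u(t) is the
    squared modulus of sum_k sin((k+1) PI / N) e^{i k t}
    ([norm_sqr_trig_sum]), hence u >= 0 ([jackson_kernel_nonneg]).

    Concentration at 0: on [0, PI] the inequality t <= PI sin(t/2) bounds t^4
    by (PI^4 / 4) (1 - cos t)^2, a trigonometric polynomial of degree 2 whose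
    integral against u only sees r_1 and r_2.  This bounds the tail of u beyond
    delta by PI^5 / (8 delta^4) times 3/2 - 2 r_1 + r_2 / 2
    ([cos_poly_tail]); with c = cos(PI/N) and s = sin(PI/N) one has r_1 = c and
    r_2 = 2 c^2 - 1 + 2 s^2 / N, so that factor equals (1 - c)^2 + s^2 / N,
    which is O(N^-3) ([jackson_moment_le]).

    The convolution is never formed as an integral.  With U the primitive of u
    vanishing at 0, the identity
      PI q_d(theta) = U(alpha + theta) + U(alpha - theta)
                      - U(beta + theta) - U(beta - theta)
    holds coefficientwise ([cheb_jackson_prim]).  Since U is odd, nondecreasing
    and satisfies U(2 PI - t) = PI - U(t), comparing these four values with
    U(delta) bounds the error by (2 / PI) (PI / 2 - U(delta))
    ([step_error_le_tail]), that is by 2 / PI times the tail of u beyond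
    delta = Delta_theta. *)

(** * Finite sums of reals *)

Lemma sum_n_m_succ_r (f : nat -> R) (m n : nat) :
  (m <= S n)%nat -> sum_n_m f m (S n) = sum_n_m f m n + f (S n).
Proof. intros H; exact (sum_n_Sm f m n H). Qed.

Lemma sum_n_m_scal_l (c : R) (f : nat -> R) (m n : nat) :
  sum_n_m (fun k => c * f k) m n = c * sum_n_m f m n.
Proof. exact (sum_n_m_mult_l c f m n). Qed.

Lemma sum_n_m_add (f g : nat -> R) (m n : nat) :
  sum_n_m (fun k => f k + g k) m n = sum_n_m f m n + sum_n_m g m n.
Proof. exact (sum_n_m_plus f g m n). Qed.

Lemma sum_n_m_ext_R (f g : nat -> R) (m n : nat) :
  (forall k, (m <= k <= n)%nat -> f k = g k) -> sum_n_m f m n = sum_n_m g m n.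
Proof. exact (sum_n_m_ext_loc f g m n). Qed.

Lemma sum_n_m_empty (f : nat -> R) (m n : nat) :
  (n < m)%nat -> sum_n_m f m n = 0.
Proof. exact (sum_n_m_zero f m n). Qed.

Lemma sum_n_m_rev (f : nat -> R) (n : nat) :
  sum_n_m (fun k => f (S n - k)%nat) 0 n = sum_n_m f 1 (S n).
Proof.
  induction n as [|n IH].
  - now rewrite !sum_n_n.
  - rewrite sum_Sn_m, <- sum_n_m_S by lia.
    rewrite (sum_n_m_succ_r f), <- IH by lia.
    apply Rplus_comm.
Qed.

(** * Positivity of the Jackson kernel *)

Definition cos_poly (r : nat -> R) (n : nat) (t : R) : R :=
  1 / 2 + sum_n_m (fun j => r j * cos (INR j * t)) 1 n.

(** Both sides are the squared modulus of sum_k a_k e^{i k t}; on the right the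
    products a_k a_l are grouped by their lag j = |k - l|, which makes the sum
    a cosine polynomial with the autocorrelations of a as coefficients. *)
Lemma norm_sqr_trig_sum (a : nat -> R) (n : nat) (t : R) :
  sum_n_m (fun k => a k * cos (INR k * t)) 0 n ^ 2
  + sum_n_m (fun k => a k * sin (INR k * t)) 0 n ^ 2
  = sum_n_m (fun k => a k ^ 2) 0 n
    + 2 * sum_n_m (fun j => cos (INR j * t)
                     * sum_n_m (fun k => a k * a (k + j)%nat) 0 (n - j)) 1 n.
Proof.
  induction n as [|n IH].
  - rewrite !sum_n_n, sum_n_m_empty by lia.
    simpl INR. rewrite Rmult_0_l, cos_0, sin_0. ring.
  - (* The new index S n interacts with k <= n at the difference j = S n - k. *)
    assert (Hcross :
      sum_n_m (fun k => a k * cos (INR k * t)) 0 n * cos (INR (S n) * t)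
      + sum_n_m (fun k => a k * sin (INR k * t)) 0 n * sin (INR (S n) * t)
      = sum_n_m (fun j => cos (INR j * t) * a (S n - j)%nat) 1 (S n)).
    { rewrite <- sum_n_m_rev.
      rewrite (Rmult_comm _ (cos _)), (Rmult_comm _ (sin _)).
      rewrite <- !sum_n_m_scal_l, <- sum_n_m_add.
      apply sum_n_m_ext_R; intros k Hk.
      replace (S n - (S n - k))%nat with k by lia.
      rewrite (minus_INR (S n) k) by lia.
      rewrite Rmult_minus_distr_r, cos_minus. ring. }
    assert (Hauto :
      sum_n_m (fun j => cos (INR j * t)
                 * sum_n_m (fun k => a k * a (k + j)%nat) 0 (S n - j)) 1 (S n)
      = sum_n_m (fun j => cos (INR j * t)
                 * sum_n_m (fun k => a k * a (k + j)%nat) 0 (n - j)) 1 n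
        + a (S n)
          * sum_n_m (fun j => cos (INR j * t) * a (S n - j)%nat) 1 (S n)).
    { rewrite !(sum_n_m_succ_r _ 1 n), Nat.sub_diag, sum_n_n by lia.
      rewrite Rmult_plus_distr_l, <- sum_n_m_scal_l, <- Rplus_assoc.
      rewrite <- sum_n_m_add.
      apply (f_equal2 Rplus); [|change (0 + S n)%nat with (S n); simpl; ring].
      apply sum_n_m_ext_R; intros j Hj.
      replace (S n - j)%nat with (S (n - j)) by lia.
      rewrite sum_n_m_succ_r by lia.
      replace (S (n - j) + j)%nat with (S n) by lia. ring. }
    rewrite Hauto, <- Hcross.
    rewrite !(sum_n_m_succ_r _ 0 n) by lia.
    pose proof (sin2_cos2 (INR (S n) * t)) as Hsc; unfold Rsqr in Hsc.
    set (C := sum_n_m (fun k => a k * cos (INR k * t)) 0 n) in *.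
    set (D := sum_n_m (fun k => a k * sin (INR k * t)) 0 n) in *.
    set (c := cos (INR (S n) * t)) in *.
    set (s := sin (INR (S n) * t)) in *.
    transitivity (C ^ 2 + D ^ 2 + 2 * a (S n) * (C * c + D * s)
                  + a (S n) ^ 2 * (s * s + c * c)); [ring|].
    rewrite IH, Hsc. ring.
Qed.

(** A product of sines is a difference of two cosines; the first depends only on
    the lag, and the second, multiplied by 2 sin x, telescopes. *)
Lemma sine_autocorrelation (x : R) (j m : nat) :
  2 * sin x * sum_n_m (fun k => sin (INR (S k) * x)
                                * sin (INR (S (k + j)) * x)) 0 m
  = INR (S m) * sin x * cos (INR j * x)
    - (sin (INR (2 * m + 3 + j) * x) - sin (INR (S j) * x)) / 2.
Proof.
  assert (Hterm : forall k, 2 * sin x * (sin (INR (S k) * x)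
                                * sin (INR (S (k + j)) * x))
    = sin x * cos (INR j * x)
      - (sin (INR (2 * k + 3 + j) * x) - sin (INR (2 * k + 1 + j) * x)) / 2).
  { intros k.
    replace (INR (2 * k + 3 + j) * x)
      with (INR (S k) * x + INR (S (k + j)) * x + x)
      by (rewrite !S_INR, !plus_INR, mult_INR; simpl; ring).
    replace (INR (2 * k + 1 + j) * x)
      with (INR (S k) * x + INR (S (k + j)) * x - x)
      by (rewrite !S_INR, !plus_INR, mult_INR; simpl; ring).
    replace (INR j * x) with (INR (S (k + j)) * x - INR (S k) * x)
      by (rewrite !S_INR, plus_INR; ring).
    rewrite sin_plus, sin_minus, cos_minus, cos_plus. field. }
  induction m as [|m IH].
  - rewrite sum_n_n, Hterm. simpl INR. rewrite Rmult_1_l. reflexivity.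
  - rewrite sum_n_m_succ_r, Rmult_plus_distr_l, IH, Hterm by lia.
    replace (2 * S m + 1 + j)%nat with (2 * m + 3 + j)%nat by lia.
    rewrite (S_INR (S m)). field.
Qed.

Lemma sin_PI_div_gt_0 (N : R) : 1 < N -> 0 < sin (PI / N).
Proof.
  intros HN. pose proof PI_RGT_0 as Hpi.
  apply sin_gt_0; [apply Rdiv_lt_0_compat; lra|].
  apply Rmult_lt_reg_r with N; [lra|]. unfold Rdiv.
  rewrite Rmult_assoc, Rinv_l by lra. nra.
Qed.

(** The Jackson factors are the normalized autocorrelations of one arch of the
    sine: at x = PI / N the boundary terms left by the telescoping combine, by
    periodicity, into sin((j+1) x). *)
Lemma jackson_autocorrelation (d j : nat) : (j <= d)%nat ->
  sum_n_m (fun k => sin (INR (S k) * (PI / (INR d + 2)))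
                    * sin (INR (S (k + j)) * (PI / (INR d + 2)))) 0 (d - j)
  = (INR d + 2) / 2 * jackson d j.
Proof.
  intros Hj.
  pose proof (pos_INR d) as Hd.
  set (N := INR d + 2). set (x := PI / N).
  assert (HN : 2 <= N) by (unfold N; lra).
  assert (Hs : 0 < sin x) by (apply sin_PI_div_gt_0; lra).
  apply Rmult_eq_reg_l with (2 * sin x); [|lra].
  rewrite (sine_autocorrelation x j (d - j)).
  (* For m = d - j the frequencies 2m + 3 + j and j + 1 add up to 2N. *)
  replace (INR (2 * (d - j) + 3 + j) * x) with (- (INR (S j) * x) + 2 * PI).
  2:{ unfold x, N. rewrite !plus_INR, mult_INR, minus_INR, S_INR by lia.
      simpl. field. fold N; lra. }
  replace (- (INR (S j) * x) + 2 * PI) with (- (INR (S j) * x) + 2 * INR 1 * PI)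
    by (simpl; ring).
  rewrite sin_period, sin_neg.
  unfold jackson. fold N.
  replace (INR j * PI / N) with (INR j * x) by (unfold x, Rdiv; ring).
  fold x.
  replace (INR (S j) * x) with (INR j * x + x) by (rewrite S_INR; ring).
  rewrite sin_plus, S_INR, minus_INR by lia.
  replace (INR d) with (N - 2) by (unfold N; ring).
  field; lra.
Qed.

Lemma jackson_0 (d : nat) : jackson d 0 = 1.
Proof.
  pose proof (pos_INR d) as Hd.
  assert (Hs : 0 < sin (PI / (INR d + 2))) by (apply sin_PI_div_gt_0; lra).
  unfold jackson. simpl (INR 0).
  replace (0 * PI / (INR d + 2)) with 0 by (field; lra).
  rewrite sin_0, cos_0. field; lra.
Qed.

Lemma jackson_kernel_nonneg (d : nat) (t : R) : 0 <= cos_poly (jackson d) d t.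
Proof.
  pose proof (pos_INR d) as Hd.
  set (x := PI / (INR d + 2)).
  pose proof (norm_sqr_trig_sum (fun k => sin (INR (S k) * x)) d t) as H.
  cbv beta in H.
  rewrite (sum_n_m_ext_R (fun j => cos (INR j * t) * _)
    (fun j => (INR d + 2) / 2 * (jackson d j * cos (INR j * t))) 1 d) in H.
  2:{ intros j Hj. unfold x. rewrite jackson_autocorrelation by lia. ring. }
  rewrite sum_n_m_scal_l in H.
  pose proof (jackson_autocorrelation d 0 (Nat.le_0_l d)) as H0.
  rewrite jackson_0, Nat.sub_0_r in H0. fold x in H0.
  rewrite (sum_n_m_ext_R (fun k => sin (INR (S k) * x) ^ 2)
    (fun k => sin (INR (S k) * x) * sin (INR (S (k + 0)) * x)) 0 d) in H.
  2:{ intros k _. rewrite Nat.add_0_r. ring. }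
  rewrite H0 in H.
  unfold cos_poly.
  apply Rmult_le_reg_l with (INR d + 2); [lra|].
  rewrite Rmult_0_r.
  eapply Rle_trans; [|right; symmetry; eapply eq_trans; [|symmetry; exact H]].
  2:{ field. }
  apply Rplus_le_le_0_compat; apply pow2_ge_0.
Qed.

(** * The primitive of a cosine polynomial *)

Definition cos_poly_prim (r : nat -> R) (n : nat) (t : R) : R :=
  t / 2 + sum_n_m (fun j => r j * (sin (INR j * t) / INR j)) 1 n.

Lemma cos_poly_succ (r : nat -> R) (n : nat) (t : R) :
  cos_poly r (S n) t = cos_poly r n t + r (S n) * cos (INR (S n) * t).
Proof. unfold cos_poly. rewrite sum_n_m_succ_r by lia. ring. Qed.

Lemma cos_poly_prim_succ (r : nat -> R) (n : nat) (t : R) :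
  cos_poly_prim r (S n) t
  = cos_poly_prim r n t + r (S n) * (sin (INR (S n) * t) / INR (S n)).
Proof. unfold cos_poly_prim. rewrite sum_n_m_succ_r by lia. ring. Qed.

Lemma cos_poly_0 (r : nat -> R) (t : R) : cos_poly r 0 t = 1 / 2.
Proof. unfold cos_poly. rewrite sum_n_m_empty by lia. ring. Qed.

Lemma cos_poly_prim_0 (r : nat -> R) (t : R) : cos_poly_prim r 0 t = t / 2.
Proof. unfold cos_poly_prim. rewrite sum_n_m_empty by lia. ring. Qed.

Lemma INR_succ_neq_0 (n : nat) : INR (S n) <> 0.
Proof. apply not_0_INR; lia. Qed.

Lemma continuous_cos_poly (r : nat -> R) (n : nat) (t : R) :
  continuous (cos_poly r n) t.
Proof.
  induction n as [|n IH].
  - apply (continuous_ext (fun _ => 1 / 2));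
      [intros; now rewrite cos_poly_0|apply continuous_const].
  - apply (continuous_ext
      (fun t => plus (cos_poly r n t) (r (S n) * cos (INR (S n) * t))));
      [intros; now rewrite cos_poly_succ|].
    apply (continuous_plus (cos_poly r n)); [exact IH|].
    apply (ex_derive_continuous (fun t => r (S n) * cos (INR (S n) * t))).
    auto_derive; trivial.
Qed.

Lemma is_derive_cos_poly_prim (r : nat -> R) (n : nat) (t : R) :
  is_derive (cos_poly_prim r n) t (cos_poly r n t).
Proof.
  induction n as [|n IH].
  - apply (is_derive_ext (fun t => t / 2));
      [intros; now rewrite cos_poly_prim_0|].
    rewrite cos_poly_0. auto_derive; trivial.
  - apply (is_derive_ext
      (fun t => plus (cos_poly_prim r n t)
                     (r (S n) * (sin (INR (S n) * t) / INR (S n)))));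
      [intros; now rewrite cos_poly_prim_succ|].
    rewrite cos_poly_succ.
    apply (is_derive_plus (cos_poly_prim r n)); [exact IH|].
    pose proof (INR_succ_neq_0 n) as Hn. set (m := INR (S n)) in *.
    auto_derive; trivial. field; exact Hn.
Qed.

Lemma is_RInt_cos_poly (r : nat -> R) (n : nat) (x y : R) :
  is_RInt (cos_poly r n) x y (cos_poly_prim r n y - cos_poly_prim r n x).
Proof.
  apply (is_RInt_derive (cos_poly_prim r n)); intros t _.
  - apply is_derive_cos_poly_prim.
  - apply continuous_cos_poly.
Qed.

Lemma cos_poly_prim_le (r : nat -> R) (n : nat) :
  (forall t, 0 <= cos_poly r n t) ->
  forall x y, x <= y -> cos_poly_prim r n x <= cos_poly_prim r n y.
Proof.
  intros Hnn x y Hxy.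
  destruct (MVT_gen (cos_poly_prim r n) x y (cos_poly r n)) as [c [_ Hc]].
  - intros; apply is_derive_cos_poly_prim.
  - intros t _. apply derivable_continuous_pt. exists (cos_poly r n t).
    apply is_derive_Reals, is_derive_cos_poly_prim.
  - specialize (Hnn c). nra.
Qed.

Lemma cos_poly_prim_opp (r : nat -> R) (n : nat) (t : R) :
  cos_poly_prim r n (- t) = - cos_poly_prim r n t.
Proof.
  induction n as [|n IH].
  - rewrite !cos_poly_prim_0. field.
  - rewrite !cos_poly_prim_succ, IH, <- Ropp_mult_distr_r, sin_neg.
    field. apply INR_succ_neq_0.
Qed.

(** Multiples of 2 PI drop out of the sines, so only the linear term sees the
    shift.  This symmetry about PI is the form in which the periodicity of the
    kernel is used. *)
Lemma cos_poly_prim_reflect (r : nat -> R) (n : nat) (t : R) :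
  cos_poly_prim r n (2 * PI - t) = PI - cos_poly_prim r n t.
Proof.
  induction n as [|n IH].
  - rewrite !cos_poly_prim_0. field.
  - rewrite !cos_poly_prim_succ, IH.
    replace (INR (S n) * (2 * PI - t))
      with (- (INR (S n) * t) + 2 * INR (S n) * PI) by ring.
    rewrite sin_period, sin_neg. field. apply INR_succ_neq_0.
Qed.

Lemma cos_poly_prim_PI (r : nat -> R) (n : nat) :
  cos_poly_prim r n PI = PI / 2.
Proof.
  pose proof (cos_poly_prim_reflect r n PI) as H.
  replace (2 * PI - PI) with PI in H by ring. lra.
Qed.

(** * Tail of a nonnegative cosine polynomial *)

Lemma is_RInt_cos_IZR (m : Z) :
  is_RInt (fun t => cos (IZR m * t)) 0 PI (if Z.eq_dec m 0 then PI else 0).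
Proof.
  destruct (Z.eq_dec m 0) as [->|Hm].
  - apply (is_RInt_ext (fun _ => 1)).
    { intros; now rewrite Rmult_0_l, cos_0. }
    replace PI with (scal (PI - 0) 1) at 2
      by (rewrite Rminus_0_r; apply Rmult_1_r).
    apply (is_RInt_const (V := R_NormedModule)).
  - assert (HmR : IZR m <> 0) by now apply not_0_IZR.
    replace 0
      with (minus (sin (IZR m * PI) / IZR m) (sin (IZR m * 0) / IZR m)) at 2.
    2:{ rewrite (sin_eq_0_1 (IZR m * PI)) by now exists m.
        rewrite Rmult_0_r, sin_0. unfold minus, plus, opp; simpl.
        field; exact HmR. }
    apply (is_RInt_derive (fun t => sin (IZR m * t) / IZR m)); intros t _.
    + auto_derive; trivial. field; exact HmR.
    + apply (ex_derive_continuous (fun t => cos (IZR m * t))).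
      auto_derive; trivial.
Qed.

(** Since j > 0, the frequency j + k never vanishes, and j - k does only on the
    diagonal. *)
Lemma is_RInt_cos_cos (j k : nat) : (0 < j)%nat ->
  is_RInt (fun t => cos (INR j * t) * cos (INR k * t)) 0 PI
    (if Nat.eq_dec j k then PI / 2 else 0).
Proof.
  intros Hj.
  pose proof (is_RInt_scal _ _ _ (1 / 2) _
    (is_RInt_plus _ _ _ _ _ _
      (is_RInt_cos_IZR (Z.of_nat j - Z.of_nat k))
      (is_RInt_cos_IZR (Z.of_nat j + Z.of_nat k)))) as H.
  match type of H with is_RInt _ _ _ ?v =>
    replace (if Nat.eq_dec j k then _ else _) with v end.
  2:{ unfold scal, plus; simpl; unfold mult; simpl.
      destruct (Nat.eq_dec j k), (Z.eq_dec (Z.of_nat j - Z.of_nat k) 0),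
        (Z.eq_dec (Z.of_nat j + Z.of_nat k) 0); try lia; field. }
  revert H; apply is_RInt_ext. intros t _.
  unfold scal, plus; simpl; unfold mult; simpl.
  rewrite minus_IZR, plus_IZR, <- !INR_IZR_INZ.
  rewrite Rmult_minus_distr_r, Rmult_plus_distr_r, cos_minus, cos_plus. field.
Qed.

Lemma is_RInt_cos_poly_cos (r : nat -> R) (k n : nat) :
  is_RInt (fun t => cos_poly r n t * cos (INR k * t)) 0 PI
    (if Nat.eq_dec k 0 then PI / 2
     else if le_dec k n then r k * (PI / 2) else 0).
Proof.
  induction n as [|n IH].
  - replace (if Nat.eq_dec k 0 then _ else _)
      with (scal (1 / 2) (if Z.eq_dec (Z.of_nat k) 0 then PI else 0)).
    2:{ unfold scal; simpl; unfold mult; simpl.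
        destruct (Nat.eq_dec k 0), (Z.eq_dec (Z.of_nat k) 0), (le_dec k 0);
          try lia; field. }
    generalize (is_RInt_scal _ _ _ (1 / 2) _ (is_RInt_cos_IZR (Z.of_nat k))).
    apply is_RInt_ext; intros t _.
    now rewrite cos_poly_0, INR_IZR_INZ.
  - pose proof (is_RInt_plus _ _ _ _ _ _ IH
      (is_RInt_scal _ _ _ (r (S n)) _
        (is_RInt_cos_cos (S n) k (Nat.lt_0_succ n)))) as H.
    match type of H with is_RInt _ _ _ ?v =>
      replace (if Nat.eq_dec k 0 then _ else _) with v end.
    2:{ destruct (Nat.eq_dec k 0), (Nat.eq_dec (S n) k), (le_dec k n),
          (le_dec k (S n)); try lia; subst;
          unfold plus, scal; simpl; unfold mult; simpl; ring. }
    revert H; apply is_RInt_ext; intros t _.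
    rewrite cos_poly_succ. unfold plus, scal; simpl; unfold mult; simpl. ring.
Qed.

(** (1 - cos t)^2 = 3/2 - 2 cos t + cos(2t) / 2, so orthogonality picks out the
    coefficients of index 0, 1 and 2. *)
Lemma is_RInt_cos_poly_one_minus_cos_sqr (r : nat -> R) (n : nat) :
  (2 <= n)%nat ->
  is_RInt (fun t => cos_poly r n t * (1 - cos t) ^ 2) 0 PI
    (PI / 2 * (3 / 2 - 2 * r 1%nat + r 2%nat / 2)).
Proof.
  intros Hn.
  pose proof (is_RInt_plus _ _ _ _ _ _
    (is_RInt_scal _ _ _ (3 / 2) _ (is_RInt_cos_poly_cos r 0 n))
    (is_RInt_plus _ _ _ _ _ _
      (is_RInt_scal _ _ _ (-2) _ (is_RInt_cos_poly_cos r 1 n))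
      (is_RInt_scal _ _ _ (1 / 2) _ (is_RInt_cos_poly_cos r 2 n)))) as H.
  destruct (le_dec 1 n); [|lia]. destruct (le_dec 2 n); [|lia].
  match type of H with is_RInt _ _ _ ?v =>
    replace (PI / 2 * _) with v end.
  2:{ unfold plus, scal; simpl; unfold mult; simpl. field. }
  revert H; apply is_RInt_ext; intros t _.
  unfold plus, scal; simpl; unfold mult; simpl.
  replace ((1 + 1) * t) with (2 * t) by ring.
  rewrite Rmult_0_l, cos_0, Rmult_1_l, (cos_2a_cos t). field.
Qed.

(** Jordan's inequality, from concavity: were the sine below its chord at y, the
    mean value theorem would give a slope less than 2 / PI before y and one
    greater than 2 / PI after y, whereas the cosine decreases. *)
Lemma jordan_sin (y : R) : 0 <= y <= PI / 2 -> 2 / PI * y <= sin y.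
Proof.
  intros Hy. pose proof PI_RGT_0 as Hpi.
  destruct (Rle_lt_dec (2 / PI * y) (sin y)) as [|Hlt]; [assumption|exfalso].
  set (f := fun x => sin x - 2 / PI * x).
  assert (Hf : forall x, is_derive f x (cos x - 2 / PI)).
  { intros x; unfold f; auto_derive; trivial. ring. }
  assert (Hc : forall x, continuity_pt f x).
  { intros x. apply derivable_continuous_pt. exists (cos x - 2 / PI).
    apply is_derive_Reals, Hf. }
  destruct (MVT_gen f 0 y (fun x => cos x - 2 / PI)) as [c1 [Hc1 E1]]; auto.
  destruct (MVT_gen f y (PI / 2) (fun x => cos x - 2 / PI))
    as [c2 [Hc2 E2]]; auto.
  rewrite Rmin_left, Rmax_right in Hc1, Hc2 by lra.
  assert (Hdec : cos c2 <= cos c1) by (apply cos_decr_1; lra).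
  unfold f in E1, E2. rewrite sin_0, sin_PI2 in *.
  replace (2 / PI * (PI / 2)) with 1 in E2 by (field; lra).
  assert (cos c1 - 2 / PI < 0).
  { apply Rnot_le_lt; intros H.
    pose proof (Rmult_le_pos _ (y - 0) H ltac:(lra)). lra. }
  assert (0 <= (2 / PI - cos c2) * (PI / 2 - y))
    by (apply Rmult_le_pos; lra).
  lra.
Qed.

Lemma pow4_le_one_minus_cos (t : R) : 0 <= t <= PI ->
  t ^ 4 <= PI ^ 4 / 4 * (1 - cos t) ^ 2.
Proof.
  intros Ht. pose proof PI_RGT_0 as Hpi.
  assert (Hj : 2 / PI * (t / 2) <= sin (t / 2)) by (apply jordan_sin; lra).
  assert (Hcos : 1 - cos t = 2 * sin (t / 2) ^ 2).
  { replace t with (2 * (t / 2)) at 1 by field. rewrite cos_2a_sin. ring. }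
  rewrite Hcos.
  replace (PI ^ 4 / 4 * (2 * sin (t / 2) ^ 2) ^ 2)
    with ((PI * sin (t / 2)) ^ 4) by field.
  apply pow_incr; split; [lra|].
  apply Rmult_le_compat_l with (r := PI) in Hj; [|lra].
  replace (PI * (2 / PI * (t / 2))) with t in Hj by (field; lra). exact Hj.
Qed.

(** A Markov-type bound: beyond delta the weight
    (PI^4 / 4) (1 - cos t)^2 / delta^4 >= t^4 / delta^4 is at least 1, and
    extending the weighted integral down to 0 can only increase it. *)
Lemma cos_poly_tail (r : nat -> R) (n : nat) (delta : R) : (2 <= n)%nat ->
  (forall t, 0 <= cos_poly r n t) -> 0 < delta <= PI ->
  PI / 2 - cos_poly_prim r n delta
  <= PI ^ 5 / (8 * delta ^ 4) * (3 / 2 - 2 * r 1%nat + r 2%nat / 2).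
Proof.
  intros Hn Hnn Hdel. pose proof PI_RGT_0 as Hpi.
  set (w := fun t => cos_poly r n t * (1 - cos t) ^ 2).
  assert (Hw : forall x y, ex_RInt w x y).
  { intros x y. apply (ex_RInt_continuous (V := R_CompleteNormedModule)).
    intros t _.
    apply (continuous_mult (cos_poly r n) (fun t => (1 - cos t) ^ 2)).
    - apply continuous_cos_poly.
    - apply (ex_derive_continuous (fun t => (1 - cos t) ^ 2)).
      auto_derive; trivial. }
  assert (Hd4 : 0 < delta ^ 4) by (apply pow_lt; lra).
  assert (H1 : PI / 2 - cos_poly_prim r n delta
               <= PI ^ 4 / (4 * delta ^ 4) * RInt w delta PI).
  { rewrite <- (cos_poly_prim_PI r n).
    rewrite <- (is_RInt_unique _ _ _ _ (is_RInt_cos_poly r n delta PI)).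
    change (PI ^ 4 / (4 * delta ^ 4) * RInt w delta PI)
      with (scal (PI ^ 4 / (4 * delta ^ 4)) (RInt w delta PI)).
    rewrite <- (RInt_scal w delta PI _ (Hw _ _)).
    apply RInt_le; [lra| | |].
    - eexists; apply is_RInt_cos_poly.
    - apply (ex_RInt_scal w), Hw.
    - intros t Ht.
      change (cos_poly r n t <= PI ^ 4 / (4 * delta ^ 4)
                                * (cos_poly r n t * (1 - cos t) ^ 2)).
      assert (Hb := pow4_le_one_minus_cos t ltac:(lra)).
      assert (Hdt : delta ^ 4 <= t ^ 4) by (apply pow_incr; lra).
      specialize (Hnn t).
      replace (PI ^ 4 / (4 * delta ^ 4) * (cos_poly r n t * (1 - cos t) ^ 2))
        with (cos_poly r n t * (PI ^ 4 / 4 * (1 - cos t) ^ 2 / delta ^ 4))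
        by (field; lra).
      rewrite <- (Rmult_1_r (cos_poly r n t)) at 1.
      apply Rmult_le_compat_l; [exact Hnn|].
      apply Rmult_le_reg_r with (delta ^ 4); [exact Hd4|].
      unfold Rdiv at 1. rewrite Rmult_assoc, Rinv_l by lra. lra. }
  assert (H2 : RInt w delta PI <= RInt w 0 PI).
  { rewrite <- (RInt_Chasles w 0 delta PI) by apply Hw.
    assert (0 <= RInt w 0 delta).
    { apply RInt_ge_0; [lra|apply Hw|].
      intros t _. apply Rmult_le_pos; [apply Hnn|apply pow2_ge_0]. }
    unfold plus; simpl. lra. }
  rewrite (is_RInt_unique w 0 PI _
    (is_RInt_cos_poly_one_minus_cos_sqr r n Hn)) in H2.
  apply Rle_trans with (1 := H1).
  apply Rle_trans with (PI ^ 4 / (4 * delta ^ 4)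
     * (PI / 2 * (3 / 2 - 2 * r 1%nat + r 2%nat / 2))).
  - apply Rmult_le_compat_l; [|exact H2].
    apply Rlt_le, Rdiv_lt_0_compat; [apply pow_lt; lra|lra].
  - right. field; lra.
Qed.

(** * Approximation of the step function *)

(** The j-th terms agree by
    2 sin(j x) cos(j th) = sin(j (x + th)) + sin(j (x - th)). *)
Lemma cos_poly_prim_combination (r : nat -> R) (n : nat) (al be th : R) :
  2 / PI * (al - be) / 2
  + sum_n_m (fun j => r j
        * (2 / PI * ((sin (INR j * al) - sin (INR j * be)) / INR j))
        * cos (INR j * th)) 1 n
  = (cos_poly_prim r n (al + th) + cos_poly_prim r n (al - th)
     - cos_poly_prim r n (be + th) - cos_poly_prim r n (be - th)) / PI.
Proof.
  pose proof PI_neq0 as Hpi.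
  induction n as [|n IH].
  - rewrite sum_n_m_empty, !cos_poly_prim_0 by lia. field; exact Hpi.
  - rewrite sum_n_m_succ_r, <- Rplus_assoc, IH, !cos_poly_prim_succ by lia.
    pose proof (INR_succ_neq_0 n) as Hn. set (m := INR (S n)) in *.
    rewrite !Rmult_minus_distr_l, !Rmult_plus_distr_l.
    rewrite !sin_plus, !sin_minus. field; split; assumption.
Qed.

Lemma cheb_jackson_prim (a b : R) (d : nat) (theta : R) :
  let U := cos_poly_prim (jackson d) d in
  cheb_jackson a b d theta
  = (U (acos a + theta) + U (acos a - theta)
     - U (acos b + theta) - U (acos b - theta)) / PI.
Proof.
  intros U; unfold U. rewrite <- cos_poly_prim_combination.
  unfold cheb_jackson. apply (f_equal2 Rplus); [reflexivity|].
  apply sum_n_m_ext_R; intros j Hj.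
  destruct j as [|j]; [lia|reflexivity].
Qed.

Lemma step_cos_inside (a b theta : R) : -1 <= a -> a <= b -> b <= 1 ->
  acos b < theta < acos a -> step_cos a b theta = 1.
Proof.
  intros ha hab hb Ht.
  pose proof (acos_bound a) as Ba. pose proof (acos_bound b) as Bb.
  assert (H1 : a < cos theta).
  { rewrite <- (cos_acos a) by lra. apply cos_decreasing_1; lra. }
  assert (H2 : cos theta < b).
  { rewrite <- (cos_acos b) by lra. apply cos_decreasing_1; lra. }
  unfold step_cos, step.
  destruct (Req_dec_T _ _); [lra|]. destruct (Req_dec_T _ _); [lra|].
  destruct (Rlt_dec _ _); [|lra]. destruct (Rlt_dec _ _); lra.
Qed.

Lemma step_cos_outside (a b theta : R) : -1 <= a -> a <= b -> b <= 1 ->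
  0 <= theta <= PI -> theta < acos b \/ acos a < theta ->
  step_cos a b theta = 0.
Proof.
  intros ha hab hb Hth Ht.
  pose proof (acos_bound a) as Ba. pose proof (acos_bound b) as Bb.
  assert (H : b < cos theta \/ cos theta < a).
  { destruct Ht as [Ht|Ht]; [left|right].
    - rewrite <- (cos_acos b) by lra. apply cos_decreasing_1; lra.
    - rewrite <- (cos_acos a) by lra. apply cos_decreasing_1; lra. }
  unfold step_cos, step.
  destruct (Req_dec_T _ _); [lra|]. destruct (Req_dec_T _ _); [lra|].
  destruct (Rlt_dec _ _); [|lra]. destruct (Rlt_dec _ _); lra.
Qed.

(** After division by PI, the combination of values of U is the mass that the
    kernel centred at th gives to the arcs [be, al] and [-al, -be] of the
    circle.  These arcs do not overlap.  For th outside [be, al] they keep a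
    distance of at least delta from th, and for th inside the complement of
    their union does; in both cases the error is at most the mass outside
    [-delta, delta].  The ordering of the endpoints on the circle appears below
    as comparisons of arguments of U, reflected in PI where needed. *)
Lemma step_error_le_tail (r : nat -> R) (n : nat) (al be th delta g : R) :
  let U := cos_poly_prim r n in
  (forall t, 0 <= cos_poly r n t) ->
  0 <= be < al -> al <= PI -> 0 <= th <= PI ->
  0 < delta -> delta <= Rabs (th - al) -> delta <= Rabs (th - be) ->
  (be < th < al -> g = 1) -> (th < be \/ al < th -> g = 0) ->
  Rabs ((U (al + th) + U (al - th) - U (be + th) - U (be - th)) / PI - g)
  <= 2 / PI * (PI / 2 - U delta).
Proof.
  intros U Hnn Hbe Hal Hth Hdel Hda Hdb Hin Hout.
  pose proof PI_RGT_0 as Hpi.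
  assert (Hmono : forall x y, x <= y -> U x <= U y)
    by (apply cos_poly_prim_le; exact Hnn).
  assert (Hodd : forall x y, x = - y -> U x = - U y)
    by (intros x y ->; apply cos_poly_prim_opp).
  assert (Hrefl : forall x y, x = 2 * PI - y -> U x = PI - U y)
    by (intros x y ->; apply cos_poly_prim_reflect).
  set (Q := U (al + th) + U (al - th) - U (be + th) - U (be - th)).
  assert (Hnum : Rabs (Q - PI * g) <= PI - 2 * U delta).
  { assert (Hcmp := Hmono (be + th) (al + th) ltac:(lra)).
    destruct (Rtotal_order th be) as [H|[H|H]].
    - rewrite Hout by lra.
      rewrite (Rabs_left (th - al)) in Hda by lra.
      rewrite (Rabs_left (th - be)) in Hdb by lra.
      assert (H1 := Hmono (be - th) (al - th) ltac:(lra)).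
      assert (H2 := Hmono delta (be - th) ltac:(lra)).
      assert (H3 := Hmono delta (be + th) ltac:(lra)).
      assert (H4 := Hmono (al - th) (2 * PI - (al + th)) ltac:(lra)).
      rewrite (Hrefl (2 * PI - (al + th)) (al + th)) in H4 by ring.
      apply Rabs_le; unfold Q; lra.
    - subst th. rewrite Rminus_diag, Rabs_R0 in Hdb. lra.
    - destruct (Rtotal_order th al) as [H'|[H'|H']].
      + rewrite Hin by lra.
        rewrite (Rabs_left (th - al)) in Hda by lra.
        rewrite (Rabs_right (th - be)) in Hdb by lra.
        unfold Q. rewrite (Hodd (be - th) (th - be)) by ring.
        assert (H1 := Hmono delta (al - th) ltac:(lra)).
        assert (H2 := Hmono delta (th - be) ltac:(lra)).
        assert (H3 := Hmono (th - be) (be + th) ltac:(lra)).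
        assert (H4 := Hmono (al - th) (2 * PI - (al + th)) ltac:(lra)).
        rewrite (Hrefl (2 * PI - (al + th)) (al + th)) in H4 by ring.
        apply Rabs_le; lra.
      + subst th. rewrite Rminus_diag, Rabs_R0 in Hda. lra.
      + rewrite Hout by lra.
        rewrite (Rabs_right (th - al)) in Hda by lra.
        rewrite (Rabs_right (th - be)) in Hdb by lra.
        unfold Q. rewrite (Hodd (be - th) (th - be)) by ring.
        rewrite (Hodd (al - th) (th - al)) by ring.
        assert (H1 := Hmono (th - al) (th - be) ltac:(lra)).
        assert (H2 := Hmono delta (th - al) ltac:(lra)).
        assert (H3 := Hmono (th - be) (be + th) ltac:(lra)).
        assert (H4 := Hmono (al + th) (2 * PI - delta) ltac:(lra)).
        rewrite (Hrefl (2 * PI - delta) delta) in H4 by ring.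
        apply Rabs_le; lra. }
  replace (Q / PI - g) with ((Q - PI * g) / PI) by (field; lra).
  unfold Rdiv at 1. rewrite Rabs_mult, (Rabs_right (/ PI)).
  2:{ apply Rle_ge, Rlt_le, Rinv_0_lt_compat, Hpi. }
  replace (2 / PI * (PI / 2 - U delta)) with ((PI - 2 * U delta) * / PI)
    by (field; lra).
  apply Rmult_le_compat_r; [|exact Hnum].
  apply Rlt_le, Rinv_0_lt_compat, Hpi.
Qed.

(** The left-hand side is (1 - c)^2 + s^2 / N with c, s the cosine and sine of
    x = PI / N.  It is at most x^4 / 4 + x^2 / N, and N >= 4 together with
    PI <= 4 makes the first term no larger than the second. *)
Lemma jackson_moment_le (d : nat) : (2 <= d)%nat ->
  3 / 2 - 2 * jackson d 1 + jackson d 2 / 2 <= 2 * PI ^ 2 / (INR d + 2) ^ 3.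
Proof.
  intros Hd. apply le_INR in Hd. simpl in Hd.
  pose proof PI_RGT_0 as Hpi. pose proof PI_4 as Hpi4.
  pose proof PI2_3_2 as Hpi3.
  unfold jackson. set (N := INR d + 2). set (x := PI / N).
  assert (HN : 4 <= N) by (unfold N; lra).
  assert (HxN : x * N = PI) by (unfold x; field; lra).
  assert (Hx0 : 0 < x) by (apply Rdiv_lt_0_compat; lra).
  assert (Hx : x <= 1) by nra.
  pose proof (sin2_cos2 x) as Hsc; unfold Rsqr in Hsc.
  assert (Hs : 0 < sin x) by (apply sin_PI_div_gt_0; lra).
  assert (Hsx : sin x <= x) by (left; apply sin_lt_x; lra).
  assert (Hc : 0 <= 1 - cos x <= x ^ 2 / 2).
  { replace (1 - cos x) with (2 * sin (x / 2) ^ 2).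
    2:{ replace x with (2 * (x / 2)) at 2 by field. rewrite cos_2a_sin. ring. }
    assert (0 < sin (x / 2)) by (apply sin_gt_0; lra).
    assert (sin (x / 2) <= x / 2) by (left; apply sin_lt_x; lra).
    nra. }
  replace (INR 1 * PI / N) with x by (unfold x; simpl; field; lra).
  replace (INR 2 * PI / N) with (2 * x) by (unfold x; simpl; field; lra).
  rewrite sin_2a, cos_2a_cos.
  replace (INR 1) with 1 by reflexivity.
  replace (INR 2) with 2 by reflexivity.
  replace (3 / 2 - 2 * (((N - 1) * sin x * cos x + cos x * sin x) / (N * sin x))
    + ((N - 2) * sin x * (2 * cos x * cos x - 1)
       + cos x * (2 * sin x * cos x)) / (N * sin x) / 2)
    with ((1 - cos x) ^ 2 + (1 - cos x * cos x) / N) by (field; lra).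
  replace (1 - cos x * cos x) with (sin x ^ 2) by (rewrite <- Hsc; ring).
  assert (Hx2 : x ^ 2 <= 4 / N).
  { apply Rmult_le_reg_r with N; [lra|].
    replace (4 / N * N) with 4 by (field; lra). nra. }
  apply Rle_trans with ((x ^ 2 / 2) ^ 2 + x ^ 2 / N).
  { apply Rplus_le_compat; [apply pow_incr; lra|].
    apply Rmult_le_compat_r; [left; apply Rinv_0_lt_compat; lra|].
    apply pow_incr; lra. }
  replace (2 * PI ^ 2 / N ^ 3) with (x ^ 2 * (2 / N))
    by (unfold x; field; lra).
  replace ((x ^ 2 / 2) ^ 2 + x ^ 2 / N) with (x ^ 2 * (x ^ 2 / 4 + / N))
    by (field; lra).
  apply Rmult_le_compat_l; [apply pow2_ge_0|]. lra.
Qed.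

Theorem theorem3p2 (a b : R) (ha : -1 <= a) (hab : a <= b) (hb : b <= 1)
    (halpha_beta : acos a > acos b)
    (theta : R) (htheta : 0 <= theta <= PI)
    (htheta_alpha : theta <> acos a) (htheta_beta : theta <> acos b)
    (d : nat) (hd : (2 <= d)%nat) :
  Rabs (cheb_jackson a b d theta - step_cos a b theta)
    <= PI ^ 6 / (2 * (INR d + 2) ^ 3 * jump_dist a b theta ^ 4).
Proof.
  pose proof PI_RGT_0 as Hpi.
  pose proof (acos_bound a) as Ba. pose proof (acos_bound b) as Bb.
  assert (Hdel : 0 < jump_dist a b theta).
  { apply Rmin_glb_lt; apply Rabs_pos_lt; lra. }
  assert (Hda : jump_dist a b theta <= Rabs (theta - acos a)) by apply Rmin_l.
  assert (Hdb : jump_dist a b theta <= Rabs (theta - acos b)) by apply Rmin_r.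
  assert (HdPI : jump_dist a b theta <= PI).
  { apply Rle_trans with (1 := Hda). apply Rabs_le; lra. }
  set (delta := jump_dist a b theta) in *.
  rewrite cheb_jackson_prim.
  eapply Rle_trans.
  { apply (step_error_le_tail (jackson d) d (acos a) (acos b) theta delta);
      try assumption; try lra.
    - apply jackson_kernel_nonneg.
    - now apply step_cos_inside.
    - now apply step_cos_outside. }
  apply Rle_trans with (2 / PI * (PI ^ 5 / (8 * delta ^ 4)
                                  * (2 * PI ^ 2 / (INR d + 2) ^ 3))).
  - apply Rmult_le_compat_l; [left; apply Rdiv_lt_0_compat; lra|].
    eapply Rle_trans.
    { apply cos_poly_tail; [exact hd|apply jackson_kernel_nonneg|lra]. }
    apply Rmult_le_compat_l; [|now apply jackson_moment_le].
    assert (0 < delta ^ 4) by (apply pow_lt; lra).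
    left; apply Rdiv_lt_0_compat; [apply pow_lt|]; lra.
  - right. pose proof (pos_INR d). field. lra.
Qed.
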